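(* The problem of online combinatorial auctions with XOS buyers admits a pointwise $576$-competitive single-sample prophet inequality. That is, there is a (possibly randomized) single-sample online algorithm $\mathsf{ALG}$ such that for all $n,m\ge1$ and all XOS valuations $v_i^1,v_i^2$ ($i\in[n]$) on the item set $[m]$, if for each $i$ independently $(S_i,V_i)$ is a uniformly random one of $(v_i^1,v_i^2)$ and $(v_i^2,v_i^1)$, then $$\mathbb{E}\Big[\sum_{i=1}^n V_i\big(\mathsf{ALG}_i(\mathbf{V};\mathbf{S})\big)\Big]\ \ge\ \frac1{576}\,\mathbb{E}\Big[\max_{(A_1,\dots,A_n)}\sum_{i=1}^n V_i(A_i)\Big],$$ where $\mathbf{S}=(S_1,\dots,S_n)$, $\mathbf{V}=(V_1,\dots,V_n)$, and the maximum is over all tuples of pairwise disjoint sets $A_1,\dots,A_n\subseteq[m]$.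
   Context: Valuations: a valuation is a function $v:2^{[m]}\to\mathbb{R}_{\ge0}$ that is normalized ($v(\emptyset)=0$) and monotone ($v(S)\le v(T)$ for $S\subseteq T$). $v$ is XOS if there is a finite collection of additive functions $a_\ell(B)=\sum_{j\in B}a_\ell(j)$ with $a_\ell(j)\ge0$ such that $v(B)=\max_\ell a_\ell(B)$ for all $B\subseteq[m]$. Online problem (Game of Googol with one sample per buyer): the adversary fixes $v_i^1,v_i^2$ for each $i$, unknown to the algorithm; random assignment to $\mathbf{S}$ (samples) and $\mathbf{V}$ (actual valuations) as in the claim. A single-sample online algorithm sees $\mathbf{S}$ in advance. Buyers arrive in the fixed, known order $1,\dots,n$; when buyer $i$ arrives, $V_i$ is revealed, and the algorithm must immediately and irrevocably allocate to $i$ a subset $\mathsf{ALG}_i(\mathbf{V};\mathbf{S})$ of the still unallocated items, based only on $\mathbf{S}$, $V_1,\dots,V_i$ and internal randomness. Expectations are over the random assignments and the algorithm's randomness. *)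

(* Defs.v *)
From HB Require Import structures.
From mathcomp Require Import all_boot all_order all_algebra.
From mathcomp Require Import all_classical all_reals all_analysis.

Set Implicit Arguments.
Unset Strict Implicit.
Unset Printing Implicit Defensive.

Import Order.TTheory GRing.Theory Num.Theory.

Local Open Scope ring_scope.

Definition setfun (R : realType) (m : nat) : Type := {set 'I_m} -> R.

Definition is_valuation (R : realType) (m : nat) (v : setfun R m) : Prop :=
  [/\ forall B, 0 <= v B,
      v finset.set0 = 0 &
      forall B C : {set 'I_m}, B \subset C -> v B <= v C].

(* The collection of additive functions is indexed by 'I_k with 0 < k. Since
   all the sums are nonnegative, the default value 0 of the iterated maximum
   does not affect its value. *)
Definition is_xos (R : realType) (m : nat) (v : setfun R m) : Prop :=
  is_valuation v /\
  exists (k : nat) (a : 'I_k -> 'I_m -> R),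
    [/\ (0 < k)%N,
        forall l j, 0 <= a l j &
        forall B : {set 'I_m},
          v B = \big[Num.max/0]_(l < k) \sum_(j in B) a l j].

Definition profile (R : realType) (n m : nat) : Type := 'I_n -> setfun R m.

Definition xos_profile (R : realType) (n m : nat) (V : profile R n m) : Prop :=
  forall i, is_xos (V i).

Definition allocation (n m : nat) := {ffun 'I_n -> {set 'I_m}}.

Definition disjoint_alloc (n m : nat) (A : allocation n m) : bool :=
  [forall i, forall j, (i != j) ==> [disjoint A i & A j]].

Definition welfare (R : realType) (n m : nat) (V : profile R n m)
    (A : allocation n m) : R :=
  \sum_(i < n) V i (A i).

(* For nonnegative valuations every welfare is nonnegative and the empty
   allocation is feasible, so the default value 0 is harmless. *)
Definition max_welfare (R : realType) (n m : nat) (V : profile R n m) : R :=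
  \big[Num.max/0]_(A : allocation n m | disjoint_alloc A) welfare V A.

(* [oa_alloc w S V] is the allocation produced with internal randomness [w],
   samples [S] and actual valuations [V]. The randomness is drawn from
   [oa_prob] once and for all, independently of the input, so that the
   decisions for different buyers may be correlated.
   [oa_online]: what buyer [i] gets depends on [V] only through the valuations
   of the buyers [0, ..., i]. As past decisions are determined by the same
   data, allocating only still unallocated items at each step amounts to
   [oa_disjoint]. *)
Record online_algorithm (R : realType) (n m : nat) := OnlineAlgorithm {
  oa_disp : measure_display;
  oa_seed : measurableType oa_disp;
  oa_prob : probability oa_seed R;
  oa_alloc : oa_seed -> profile R n m -> profile R n m -> allocation n m;
  oa_disjoint : forall w S V, xos_profile S -> xos_profile V ->
    disjoint_alloc (oa_alloc w S V);
  oa_online : forall w S V V' (i : 'I_n),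
    xos_profile S -> xos_profile V -> xos_profile V' ->
    (forall j : 'I_n, (j <= i)%N -> V j = V' j) ->
    oa_alloc w S V i = oa_alloc w S V' i;
  oa_measurable : forall S V (i : 'I_n) (B : {set 'I_m}),
    xos_profile S -> xos_profile V ->
    measurable [set w | oa_alloc w S V i = B]%classic
}.

Arguments oa_alloc {R n m} o w S V.

(* [c i = false] stands for (S_i, V_i) = (v1 i, v2 i), and [c i = true] for
   (S_i, V_i) = (v2 i, v1 i). *)
Definition samples (R : realType) (n m : nat) (v1 v2 : profile R n m)
    (c : {ffun 'I_n -> bool}) : profile R n m :=
  fun i => if c i then v2 i else v1 i.

Definition actuals (R : realType) (n m : nat) (v1 v2 : profile R n m)
    (c : {ffun 'I_n -> bool}) : profile R n m :=
  fun i => if c i then v1 i else v2 i.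

(* Independent fair coins, one per buyer, make all the 2 ^ n assignments
   equally likely. *)
Definition assignment_mean (R : realType) (n : nat)
    (f : {ffun 'I_n -> bool} -> \bar R) : \bar R :=
  (\sum_(c : {ffun 'I_n -> bool}) ((2 ^+ n)^-1 : R)%:E * f c)%E.

(* The internal randomness is independent of the assignment. *)
Definition expected_welfare (R : realType) (n m : nat)
    (ALG : online_algorithm R n m) (v1 v2 : profile R n m) : \bar R :=
  assignment_mean (fun c =>
    'E_(oa_prob ALG)[fun w => welfare (actuals v1 v2 c)
       (oa_alloc ALG w (samples v1 v2 c) (actuals v1 v2 c))])%E.

Definition expected_optimum (R : realType) (n m : nat)
    (v1 v2 : profile R n m) : \bar R :=
  assignment_mean (fun c => (max_welfare (actuals v1 v2 c))%:E).

(* Main.v *)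
(* When buyer i arrives, both valuations of every earlier buyer are known, so a
   uniformly random one of the two is a fresh draw, independent of all coins.
   Buyer i looks at the optimal allocation of the profile made of such fresh
   draws for the earlier buyers, V_i itself, and the samples of the later ones.
   This profile is distributed like V, so the bundles A_i found in this way are
   worth the expected optimum in total. Buyer i requests A_i with probability
   1/2. Given S_i, S_{i+1}, ..., the profile of each earlier buyer k < i has
   these coordinates from i on and uniformly random ones before i, and this
   remains true when the profile of buyer i is given as well. So the conditional
   probabilities that item j belongs to A_k sum to at most 1 over k < i, and the
   union bound leaves every requested item available with probability at least
   1/2. Additive functions supporting the XOS valuations turn this into 1/4 of
   the expected optimum, which is more than 1/576 of it. *)
From HB Require Import structures.
Require Import Defs.
From mathcomp Require Import all_boot all_order all_algebra.
From mathcomp Require Import all_classical all_reals all_analysis.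
From mathcomp Require Import ring lra.

Set Implicit Arguments.
Unset Strict Implicit.
Unset Printing Implicit Defensive.

Import Order.TTheory GRing.Theory Num.Theory.

Local Open Scope ring_scope.

(** * Averages over finite types *)

Definition mean (R : realType) (T : finType) (f : T -> R) : R :=
  #|T|%:R^-1 * \sum_t f t.

Section Mean.
Variable R : realType.
Implicit Types T U : finType.

Lemma eq_mean T (f g : T -> R) : f =1 g -> mean f = mean g.
Proof. by move=> fg; rewrite /mean (eq_bigr g). Qed.

Lemma ler_mean T (f g : T -> R) : (forall t, f t <= g t) -> mean f <= mean g.
Proof.
by move=> fg; rewrite ler_wpM2l ?invr_ge0// ler_sum// => t _; exact: fg.
Qed.

Lemma mean_ge0 T (f : T -> R) : (forall t, 0 <= f t) -> 0 <= mean f.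
Proof. by move=> f0; rewrite mulr_ge0 ?invr_ge0// sumr_ge0. Qed.

Lemma meanZl T (a : R) (f : T -> R) : mean (fun t => a * f t) = a * mean f.
Proof. by rewrite /mean -mulr_sumr mulrCA. Qed.

Lemma meanZr T (a : R) (f : T -> R) : mean (fun t => f t * a) = mean f * a.
Proof. by rewrite /mean -mulr_suml mulrA. Qed.

Lemma meanB T (f g : T -> R) :
  mean (fun t => f t - g t) = mean f - mean g.
Proof. by rewrite /mean sumrB mulrBr. Qed.

Lemma mean_sum T (I : finType) (P : pred I) (f : I -> T -> R) :
  mean (fun t => \sum_(i | P i) f i t) = \sum_(i | P i) mean (f i).
Proof. by rewrite /mean exchange_big /= mulr_sumr. Qed.

Lemma mean_cst T (a : R) : (0 < #|T|)%N -> mean (fun _ : T => a) = a.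
Proof.
move=> T0; rewrite /mean sumr_const -[a *+ _]mulr_natl mulrA mulVf ?mul1r//.
by rewrite pnatr_eq0 -lt0n.
Qed.

Lemma mean_inj T (h : T -> T) (f : T -> R) :
  injective h -> mean (fun t => f (h t)) = mean f.
Proof. by move=> hI; rewrite /mean [in RHS](reindex_inj hI). Qed.

Lemma mean_pair T U (f : T -> U -> R) :
  mean (fun t => mean (f t)) = mean (fun p : T * U => f p.1 p.2).
Proof.
rewrite /mean -mulr_sumr mulrA card_prod natrM invfM pair_bigA /=.
by [].
Qed.

Lemma exchange_mean T U (f : T -> U -> R) :
  mean (fun t => mean (f t)) = mean (fun u => mean (f ^~ u)).
Proof.
rewrite /mean -2!mulr_sumr exchange_big /= mulrCA; congr (_ * (_ * _)).
Qed.

(** A uniformly random function has independent uniform coordinates: distribute the product over the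
    sums. *)
Lemma mean_prod (I J : finType) (F : I -> J -> R) :
  mean (fun r : {ffun I -> J} => \prod_i F i (r i)) = \prod_i mean (F i).
Proof.
rewrite /mean -bigA_distr_bigA big_split /= prodr_const card_ffun natrX exprVn.
by [].
Qed.

Lemma mean_coord (I J : finType) (i : I) (f : J -> R) : (0 < #|J|)%N ->
  mean (fun r : {ffun I -> J} => f (r i)) = mean f.
Proof.
move=> J0; pose F l := if l == i then f else fun=> 1.
have := mean_prod F; rewrite (bigD1 i) //= /F eqxx big1 ?mulr1; last first.
  by move=> l /negPf ->; rewrite mean_cst.
move<-; apply: eq_mean => r; rewrite (bigD1 i) //= eqxx big1 ?mulr1//.
by move=> l /negPf ->.
Qed.

Lemma mean_coord2 (I J : finType) (i k : I) (f g : J -> R) :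
  (0 < #|J|)%N -> k != i ->
  mean (fun r : {ffun I -> J} => f (r i) * g (r k)) = mean f * mean g.
Proof.
move=> J0 ki; pose F l := if l == i then f else if l == k then g else fun=> 1.
have := mean_prod F.
rewrite (bigD1 i) //= (bigD1 k) //= /F eqxx (negPf ki) eqxx big1 ?mulr1.
  move<-; apply: eq_mean => r.
  rewrite (bigD1 i) //= (bigD1 k) //= eqxx (negPf ki) eqxx big1 ?mulr1//.
  by move=> l /andP[/negPf -> /negPf ->].
by move=> l /andP[/negPf -> /negPf ->]; rewrite mean_cst.
Qed.

End Mean.

(** * Resampling the coins of the earlier buyers *)

Section Resampling.
Variables (R : realType) (n : nat).
Local Notation bits := {ffun 'I_n -> bool}.
Implicit Types (x y c : bits) (i k : 'I_n).

Definition mix i x y : bits := [ffun k : 'I_n => if (k < i)%N then x k else y k].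
Definition flip i x : bits := [ffun k => (k == i) (+) x k].
Definition xnor x y : bits := [ffun k => x k == y k].

Lemma flipK i : involutive (flip i).
Proof. by move=> x; apply/ffunP => k; rewrite !ffunE addbA addbb. Qed.

Lemma xnorK y : involutive (xnor ^~ y).
Proof. by move=> x; apply/ffunP => k; rewrite /= !ffunE; case: (x k); case: (y k). Qed.

Lemma flip_mix k i x y : (k < i)%N -> flip k (mix i x y) = mix i (flip k x) y.
Proof.
move=> ki; apply/ffunP => l; rewrite !ffunE; case: ifP => // li.
by rewrite (_ : l == k = false)//; apply/eqP => e; rewrite e ki in li.
Qed.

Lemma flip_mixr i x y : flip i (mix i x y) = mix i x (flip i y).
Proof.
apply/ffunP => l; rewrite !ffunE; case: ifP => // li.
by rewrite (_ : l == i = false)//; apply/eqP => e; rewrite e ltnn in li.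
Qed.

Lemma mix_mix k i x y z : (k <= i)%N ->
  mix k x (mix i y z) = mix i (mix k x y) z.
Proof.
move=> ki; apply/ffunP => l; rewrite !ffunE.
by case: (ltnP l i) => // il; rewrite ltnNge (leq_trans ki il).
Qed.

Lemma mix_mixl i x y z : mix i x (mix i y z) = mix i x z.
Proof. by apply/ffunP => l; rewrite !ffunE; case: (l < i)%N. Qed.

Lemma bits_gt0 : (0 < #|{: bits}|)%N.
Proof. by rewrite card_ffun card_bool expn_gt0. Qed.

(** Exchanging the prefixes of two strings is an involution on pairs, so it preserves the uniform
    law. *)
Lemma mean_swap_mix i (H : bits -> bits -> R) :
  mean (fun x => mean (fun y => H (mix i x y) (mix i y x)))
  = mean (fun x => mean (H x)).
Proof.
rewrite (mean_pair H) mean_pair.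
pose h (p : bits * bits) := (mix i p.1 p.2, mix i p.2 p.1).
have hK : involutive h.
  move=> [x y]; rewrite /h /=; congr (_, _);
    by apply/ffunP => k; rewrite !ffunE; case: (k < i)%N.
by rewrite -(mean_inj (fun p => H p.1 p.2) (inv_inj hK)).
Qed.

Lemma mean_resample i (h : bits -> R) :
  mean (fun c => mean (fun x => h (mix i x c))) = mean h.
Proof.
rewrite exchange_mean (mean_swap_mix i (fun x _ => h x)).
by apply: eq_mean => x; rewrite mean_cst// bits_gt0.
Qed.

(** Since [A] reads only the coordinates from [i] on, [B] may be replaced by its conditional mean
    given these coordinates. *)
Lemma mean_condition i (A B : bits -> R) :
  (forall x c, A (mix i x c) = A c) ->
  mean (fun c => A c * B c)
  = mean (fun c => A c * mean (fun x => B (mix i x c))).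
Proof.
move=> hA; rewrite -(mean_resample i); apply: eq_mean => c.
by rewrite -meanZl; apply: eq_mean => x; rewrite hA.
Qed.

(** Flipping bit [i] exchanges the weights [x i] and [~~ x i], which add up to 1. *)
Lemma mean_coin i (h : bits -> R) : (forall x, h (flip i x) = h x) ->
  mean (fun x : bits => (x i)%:R * h x) = 2^-1 * mean h.
Proof.
move=> hh; set L := LHS.
have : L = mean (fun x => (~~ x i)%:R * h x).
  rewrite /L -(mean_inj _ (inv_inj (flipK i))); apply: eq_mean => x.
  by rewrite hh ffunE eqxx.
have : mean h = L + mean (fun x => (~~ x i)%:R * h x).
  rewrite /mean -mulrDr -big_split /=; congr (_ * _); apply: eq_bigr => x _.
  by case: (x i) => /=; ring.
by move=> -> <-; lra.
Qed.

(** The coins that yield the profile seen by buyer [i] when read through [samples]: flipping coin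
    [i] turns [S_i] into [V_i], and [xnor] keeps or negates each earlier coin according to [s]. *)
Definition world_bits i (s c : bits) : bits := mix i (xnor s c) (flip i c).

(** Bit [i] of [s] is independent of the earlier bits, and [xnor] with a fixed [c] is a bijection,
    so the prefix stays uniform. *)
Lemma mean_world i c (h : bits -> R) :
  mean (fun s : bits => (s i)%:R * h (world_bits i s c))
  = 2^-1 * mean (fun x => h (mix i x (flip i c))).
Proof.
rewrite mean_coin => [|x]; last first.
  rewrite /world_bits; congr h; apply/ffunP => k; rewrite !ffunE.
  case: ifP => // ki; rewrite (_ : k == i = false)//.
  by apply/eqP => e; rewrite e ltnn in ki.
by congr (_ * _); rewrite /world_bits (mean_inj (fun s => h (mix i s (flip i c)))
  (inv_inj (xnorK c))).
Qed.

(** Used for a single item: [f] is its worth in the bundle of buyer [i], [g k] indicates that it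
    lies in the bundle of buyer [k], and the last factor is the union bound on availability. The
    coin of buyer [i] costs one factor 1/2, availability the other. *)
Lemma mean_available (i : 'I_n) (f : bits -> R) (g : 'I_n -> bits -> R) :
  (forall y, 0 <= f y) -> (forall y, \sum_(k < n | (k < i)%N) g k y <= 1) ->
  4^-1 * mean f <=
  mean (fun c => mean (fun r : {ffun 'I_n -> bits} =>
    (r i i)%:R * f (world_bits i (r i) c) *
    (1 - \sum_(k < n | (k < i)%N) (r k k)%:R * g k (world_bits k (r k) c)))).
Proof.
move=> f0 g1.
(* For fixed [c], the strings [r i] and [r k] are independent, so the mean over [r] factors into [F]
   and [G k]. *)
pose F c := 2^-1 * mean (fun x => f (mix i x (flip i c))).
pose G k c := 2^-1 * mean (fun x => g k (mix k x (flip k c))).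
have -> : mean (fun c => mean (fun r : {ffun 'I_n -> bits} =>
    (r i i)%:R * f (world_bits i (r i) c) *
    (1 - \sum_(k < n | (k < i)%N) (r k k)%:R * g k (world_bits k (r k) c))))
  = mean (fun c => F c * (1 - \sum_(k < n | (k < i)%N) G k c)).
  apply: eq_mean => c.
  under eq_mean do rewrite mulrBr mulr1 mulr_sumr.
  rewrite meanB mean_sum mulrBr mulr1 mulr_sumr.
  rewrite (mean_coord i (fun s : bits => (s i)%:R * f (world_bits i s c)) bits_gt0).
  rewrite mean_world; congr (_ - _); apply: eq_bigr => k ki.
  rewrite (mean_coord2 (i := i) (k := k) (fun s : bits => (s i)%:R * f (world_bits i s c))
    (fun s : bits => (s k)%:R * g k (world_bits k s c)) bits_gt0).
    by rewrite !mean_world.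
  by apply/eqP => e; rewrite e ltnn in ki.
have F0 c : 0 <= F c by rewrite mulr_ge0 ?invr_ge0// mean_ge0.
(* The fresh prefix in [F] overwrites the coins before [i], which allows conditioning on the
   others. *)
have Fmix x c : F (mix i x c) = F c.
  congr (_ * _); apply: eq_mean => y; by rewrite flip_mixr mix_mixl.
have Fmean : mean F = 2^-1 * mean f.
  rewrite meanZl; congr (_ * _); rewrite -(mean_resample i f).
  by rewrite (mean_inj (fun c => mean (fun x => f (mix i x c))) (inv_inj (flipK i))).
(* As [k < i], the flip and the resampling done by [G k] stay within the prefix [x], which is
   uniform anyway. *)
have Gmean k c : (k < i)%N ->
    mean (fun x => G k (mix i x c)) = 2^-1 * mean (fun x => g k (mix i x c)).
  move=> ki; rewrite meanZl; congr (_ * _).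
  rewrite -(mean_resample k (fun x => g k (mix i x c))).
  rewrite -(mean_inj _ (inv_inj (flipK k))); apply: eq_mean => x.
  by apply: eq_mean => y; rewrite flip_mix// flipK mix_mix// ltnW.
rewrite (mean_condition _ Fmix).
have -> : 4^-1 * mean f = mean (fun c => F c * 2^-1) by rewrite meanZr Fmean; lra.
apply: ler_mean => c; apply: ler_wpM2l => //.
rewrite meanB mean_sum mean_cst ?bits_gt0//.
rewrite (eq_bigr (fun k => 2^-1 * mean (fun x => g k (mix i x c)))); last first.
  by move=> k ki; rewrite Gmean.
rewrite -mulr_sumr -mean_sum.
(* All [g k] are now evaluated at the same string, so the pointwise bound [g1] applies. *)
suff : mean (fun x => \sum_(k < n | (k < i)%N) g k (mix i x c)) <= 1 by lra.
rewrite -[leRHS](mean_cst (T := {ffun 'I_n -> bool}) _ bits_gt0).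
by apply: ler_mean.
Qed.

End Resampling.

(** * The resampling algorithm and its guarantee *)

Section Algorithm.
Variables (R : realType) (n m : nat).
Local Notation bits := {ffun 'I_n -> bool}.
Local Notation seed := {ffun 'I_n -> bits}.
Implicit Types (S V W : profile R n m) (i k : 'I_n).

Lemma xos_support (v : setfun R m) (B : {set 'I_m}) : is_xos v ->
  exists a : 'I_m -> R, [/\ forall j, 0 <= a j, v B = \sum_(j in B) a j &
    forall C : {set 'I_m}, \sum_(j in C) a j <= v C].
Proof.
move=> [_ [K [a [K0 a0 va]]]].
(* The default 0 lies below every sum and [K0] provides an index, so some [a l] attains the maximum
   at [B]. *)
have [l _ vB] := @eq_bigmax _ _ _ 0 (Ordinal K0) xpredT
  (fun l => \sum_(j in B) a l j) isT (fun l _ => sumr_ge0 _ (fun j _ => a0 l j)).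
exists (a l); split => //; first by rewrite va vB.
by move=> C; rewrite va (le_bigmax 0 (fun l => \sum_(j in C) a l j)).
Qed.

Definition opt_alloc W : allocation n m :=
  [arg max_(A > ([ffun=> finset.set0] : allocation n m) | disjoint_alloc A)
     welfare W A]%O.

Lemma opt_allocP W : disjoint_alloc (opt_alloc W) /\
  forall A, disjoint_alloc A -> welfare W A <= welfare W (opt_alloc W).
Proof.
rewrite /opt_alloc; case: arg_maxP => [|A dA optA]; last by split.
apply/forallP => i; apply/forallP => k; apply/implyP => _.
by rewrite !ffunE finset.disjoints_subset finset.sub0set.
Qed.

Lemma max_welfare_opt W : xos_profile W ->
  max_welfare W <= welfare W (opt_alloc W).
Proof.
move=> xW; apply: bigmax_le => [|A dA]; last exact: (opt_allocP W).2.
by apply: sumr_ge0 => i _; case: (xW i) => [[]].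
Qed.

Definition world (s : bits) S V i : profile R n m := fun k =>
  if (k < i)%N then if s k then S k else V k
  else if k == i then V k else S k.

(* [world] only reads the bits [s k] with [k < i], so that the diagonal bit
   [r i i] serves as an independent coin. *)
Definition request (r : seed) S V i : {set 'I_m} :=
  if r i i then opt_alloc (world (r i) S V i) i else finset.set0.

(** An item goes to the first buyer who requests it, so removing all earlier requests removes
    exactly the items already allocated. *)
Definition resampling_alloc (r : seed) S V : allocation n m :=
  [ffun i => request r S V i :\: \bigcup_(k < n | (k < i)%N) request r S V k].

Lemma resampling_disjoint r S V : disjoint_alloc (resampling_alloc r S V).
Proof.
have lt_disj i k : (i < k)%N ->
    [disjoint resampling_alloc r S V i & resampling_alloc r S V k].
  move=> ik; rewrite !ffunE -finset.setI_eq0; apply/eqP/finset.setP => j; rewrite !inE.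
  apply/negP => /andP[/andP[_ ji] /andP[/finset.bigcupP[]]].
  by exists i.
apply/forallP => i; apply/forallP => k; apply/implyP => ik.
case: (ltngtP i k) => [/lt_disj//|/lt_disj|/ord_inj e].
  by rewrite disjoint_sym.
by rewrite e eqxx in ik.
Qed.

Lemma request_online r S V V' i :
  (forall k : 'I_n, (k <= i)%N -> V k = V' k) ->
  request r S V i = request r S V' i.
Proof.
move=> VV'; rewrite /request; case: (r i i) => //.
congr (opt_alloc _ _); apply: funext => k; rewrite /world.
case: ifP => [/ltnW /VV' -> //|_]; case: eqP => // ->.
by rewrite VV'.
Qed.

Lemma resampling_online r S V V' i :
  (forall k : 'I_n, (k <= i)%N -> V k = V' k) ->
  resampling_alloc r S V i = resampling_alloc r S V' i.
Proof.
move=> VV'; rewrite !ffunE (request_online _ _ VV'); congr (_ :\: _).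
apply: eq_bigr => k ki; apply: request_online => l lk; apply: VV'.
exact: leq_trans lk (ltnW ki).
Qed.

Lemma world_samples (v1 v2 : profile R n m) (s c : bits) i :
  world s (samples v1 v2 c) (actuals v1 v2 c) i
  = samples v1 v2 (world_bits i s c).
Proof.
apply: funext => k; rewrite /world /samples /actuals !ffunE.
case: ltnP => _; first by case: (s k); case: (c k).
by case: eqP => _; case: (c k).
Qed.

Lemma samples_xos (v1 v2 : profile R n m) c : xos_profile v1 -> xos_profile v2 ->
  xos_profile (samples v1 v2 c).
Proof. by move=> x1 x2 i; rewrite /samples; case: ifP. Qed.

Lemma actuals_samples (v1 v2 : profile R n m) (c : bits) :
  actuals v1 v2 c = samples v1 v2 [ffun k => ~~ c k].
Proof. by apply: funext => k; rewrite /actuals /samples ffunE; case: (c k). Qed.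

(** Supporting additive functions split the optimum into contributions of pairs of a buyer and an
    item, each handled by [mean_available]. *)
Lemma mean_resampling (v1 v2 : profile R n m) : xos_profile v1 -> xos_profile v2 ->
  4^-1 * mean (fun c => max_welfare (actuals v1 v2 c)) <=
  mean (fun c => mean (fun r : seed => welfare (actuals v1 v2 c)
    (resampling_alloc r (samples v1 v2 c) (actuals v1 v2 c)))).
Proof.
move=> x1 x2; pose P := @samples R n m v1 v2; pose A (y : bits) := opt_alloc (P y).
have /choice[a aP] (yi : bits * 'I_n) : exists a : 'I_m -> R,
    [/\ forall j, 0 <= a j,
        P yi.1 yi.2 (A yi.1 yi.2) = \sum_(j in A yi.1 yi.2) a j &
        forall C : {set 'I_m}, \sum_(j in C) a j <= P yi.1 yi.2 C].
  by apply: xos_support; exact: samples_xos.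
pose g j k y : R := (j \in A y k)%:R.
pose f i j y := g j i y * a (y, i) j.
have f0 i j y : 0 <= f i j y by rewrite mulr_ge0//; case: (aP (y, i)).
have g1 i j y : \sum_(k < n | (k < i)%N) g j k y <= 1.
  have [dA _] := opt_allocP (P y).
  have [k /andP[ki jk]|none] := pickP [pred k : 'I_n | (k < i)%N && (j \in A y k)].
    rewrite (bigD1 k)//= big1 ?addr0 => [|l /andP[_ lk]]; first by rewrite /g jk.
    move/forallP/(_ l)/forallP/(_ k)/implyP/(_ lk): dA.
    rewrite /g => /pred0P/(_ j)/=; rewrite -/(A y) jk andbT => ->.
    by [].
  rewrite big1 // => k ki; have := none k; rewrite /= ki /= /g => ->.
  by [].
(* Negating all coins is a bijection that exchanges samples and actual valuations. *)
have -> : mean (fun c => max_welfare (actuals v1 v2 c))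
    = mean (fun c => max_welfare (P c)).
  have negI : injective (fun c : bits => [ffun k => ~~ c k] : bits).
    by move=> c c' /ffunP cc; apply/ffunP => k; have := cc k; rewrite !ffunE => /negb_inj.
  by rewrite -(mean_inj (fun c => max_welfare (P c)) negI);
    apply: eq_mean => c; rewrite actuals_samples.
have optE : mean (fun c => max_welfare (P c)) <= \sum_i \sum_j mean (f i j).
  rewrite (eq_bigr (fun i => mean (fun y => \sum_j f i j y))); last first.
    by move=> i _; rewrite mean_sum.
  rewrite -mean_sum; apply: ler_mean => y.
  apply: le_trans (max_welfare_opt _) _; first exact: samples_xos.
  apply: ler_sum => i _; have [_ /= -> _] := aP (y, i).
  rewrite big_mkcond; apply: ler_sum => j _; rewrite /f /g.
  by case: (j \in A y i); rewrite ?mul1r ?mul0r.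
apply: (@le_trans _ _ (4^-1 * \sum_i \sum_j mean (f i j))).
  by rewrite ler_wpM2l.
rewrite mulr_sumr; under eq_bigr do rewrite mulr_sumr.
have := fun i j => mean_available (f0 i j) (g1 i j).
set B := (X in forall i j, _ <= X i j).
move=> fB; apply: (@le_trans _ _ (\sum_i \sum_j B i j)).
  by apply: ler_sum => i _; apply: ler_sum => j _; exact: fB.
rewrite {fB}/B.
under eq_bigr do rewrite -mean_sum.
rewrite -mean_sum; apply: ler_mean => c.
under eq_bigr do rewrite -mean_sum.
rewrite -mean_sum; apply: ler_mean => r.
apply: ler_sum => i _.
set S := samples v1 v2 c; set V := actuals v1 v2 c.
have reqE k j : (r k k)%:R * g j k (world_bits k (r k) c)
    = (j \in request r S V k)%:R.
  rewrite /request world_samples /g /A.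
  by case: (r k k); rewrite ?mul1r ?mul0r// inE.
(* The world of buyer [i] contains the true [V i], so its supporting function bounds from below the
   value of whatever part of the request is received. *)
have ViE : V i = P (world_bits i (r i) c) i.
  by rewrite /P -world_samples /world ltnn eqxx.
have [a0 _ aV] := aP (world_bits i (r i) c, i).
rewrite ViE; apply: le_trans (aV _).
rewrite [leRHS]big_mkcond; apply: ler_sum => j _.
rewrite /f mulrA reqE (eq_bigr (fun k : 'I_n => (j \in request r S V k)%:R));
  last by move=> k _; rewrite reqE.
rewrite ffunE finset.in_setD.
(* For a requested [j]: if an earlier buyer requested it too, the sum is at least 1 and the left
   side is nonpositive; otherwise the availability factor is at most 1. *)
case: (boolP (j \in request r S V i)) => ji; rewrite ?mul0r ?mul1r ?andbT ?andbF//.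
case: ifPn => [_|].
  by rewrite ler_piMr// gerBl sumr_ge0.
rewrite negbK => /finset.bigcupP[k ki jk].
rewrite mulr_ge0_le0// subr_le0 (bigD1 k)//= jk.
by rewrite lerDl sumr_ge0.
Qed.

End Algorithm.

(** * Uniform finite randomness realised on [nat] *)

Section UniformPoints.
Variables (R : realType) (N : nat).

Definition uniform_points : set nat -> \bar R :=
  mscale (N.+1%:R^-1)%:nng
    (msum (fun k => \d_k : {measure set nat -> \bar R}) N.+1).

HB.instance Definition _ := Measure.on uniform_points.

Lemma uniform_pointsT : uniform_points setT = 1%E.
Proof.
rewrite /uniform_points /mscale /= /msum /=.
under eq_bigr do rewrite diracT.
by rewrite sumEFin sumr_const card_ord -EFinM mulVf// pnatr_eq0.
Qed.

HB.instance Definition _ :=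
  Measure_isProbability.Build _ _ _ uniform_points uniform_pointsT.

Lemma expectation_uniform_points (X : nat -> R) : (forall k, 0 <= X k) ->
  'E_uniform_points[X]%E = (N.+1%:R^-1 * \sum_(k < N.+1) X k)%:E.
Proof.
move=> X0; rewrite unlock ge0_integral_mscale//=; last by move=> k _; rewrite lee_fin.
rewrite ge0_integral_measure_sum//=; last by move=> k _; rewrite lee_fin.
under eq_bigr do rewrite integral_dirac// diracT mul1e.
by rewrite sumEFin -EFinM.
Qed.

End UniformPoints.

(** Decoding uniform points through [enum T] gives the uniform law on [T]. Seeds live in [nat],
    where every set is measurable. *)
Lemma uniform_probability (R : realType) (T : finType) (t0 : T) :
  exists (P : probability nat R) (d : nat -> T), forall X : T -> R,
    (forall t, 0 <= X t) -> 'E_P[fun k => X (d k)]%E = (mean X)%:E.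
Proof.
have T0 : (0 < #|T|)%N by apply/card_gt0P; exists t0.
exists (uniform_points R #|T|.-1), (nth t0 (enum T)) => X X0.
rewrite expectation_uniform_points// prednK//; congr (_ * _)%:E.
by rewrite -[RHS]big_enum /= (big_nth t0) -cardE big_mkord.
Qed.

Lemma resampling_algorithm (R : realType) (n m : nat) :
  exists ALG : online_algorithm R n m, forall v1 v2 : profile R n m,
    xos_profile v1 -> xos_profile v2 ->
    ((4^-1)%:E * expected_optimum v1 v2 <= expected_welfare ALG v1 v2)%E.
Proof.
have [P [d Pd]] := uniform_probability R
  ([ffun=> [ffun=> true]] : {ffun 'I_n -> {ffun 'I_n -> bool}}).
have disj w S V : xos_profile S -> xos_profile V ->
    disjoint_alloc (@resampling_alloc R n m (d w) S V).
  by move=> _ _; exact: resampling_disjoint.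
have onl w S V V' (i : 'I_n) :
    xos_profile S -> xos_profile V -> xos_profile V' ->
    (forall j : 'I_n, (j <= i)%N -> V j = V' j) ->
    @resampling_alloc R n m (d w) S V i = resampling_alloc (d w) S V' i.
  by move=> _ _ _; exact: resampling_online.
have meas S V (i : 'I_n) (B : {set 'I_m}) :
    xos_profile S -> xos_profile V ->
    measurable [set w | @resampling_alloc R n m (d w) S V i = B]%classic.
  by [].
exists (OnlineAlgorithm P disj onl meas) => v1 v2 x1 x2.
have meanE (h : {ffun 'I_n -> bool} -> R) :
    assignment_mean (fun c => (h c)%:E) = (mean h)%:E.
  rewrite /assignment_mean /mean card_ffun card_bool card_ord natrX mulr_sumr.
  by rewrite -sumEFin; apply: eq_bigr => c _; rewrite EFinM.
rewrite /expected_optimum /expected_welfare meanE /=.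
have -> : assignment_mean (fun c => 'E_P[fun w => welfare (actuals v1 v2 c)
      (resampling_alloc (d w) (samples v1 v2 c) (actuals v1 v2 c))])%E
    = assignment_mean (fun c => (mean (fun r => welfare (actuals v1 v2 c)
      (resampling_alloc r (samples v1 v2 c) (actuals v1 v2 c))))%:E).
  congr assignment_mean; apply: funext => c.
  rewrite (Pd (fun r => welfare (actuals v1 v2 c)
    (resampling_alloc r (samples v1 v2 c) (actuals v1 v2 c))))// => r.
  apply: sumr_ge0 => i _; rewrite actuals_samples.
  by have [[]] := samples_xos [ffun k => ~~ c k] x1 x2 i.
by rewrite meanE -EFinM lee_fin mean_resampling.
Qed.

Theorem theorem3p1 (R : realType) :
  exists ALG : forall n m : nat, online_algorithm R n m,
  forall (n m : nat) (v1 v2 : profile R n m),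
    (1 <= n)%N -> (1 <= m)%N ->
    xos_profile v1 -> xos_profile v2 ->
    ((576%:R^-1 : R)%:E * expected_optimum v1 v2
       <= expected_welfare (ALG n m) v1 v2)%E.
Proof.
(* The algorithm is chosen from [n] and [m] alone, before the valuations. *)
exists (fun n m => projT1 (cid (resampling_algorithm R n m))).
move=> n m v1 v2 _ _ x1 x2; case: cid => ALG ALGP /=.
(* Weakening 1/4 to 1/576 requires a nonnegative optimum, which the default 0 of the maximum
   provides. *)
apply: le_trans (ALGP v1 v2 x1 x2); apply: lee_wpmul2r; last first.
  by rewrite lee_fin lef_pV2 ?posrE// ler_nat.
rewrite /expected_optimum /assignment_mean sume_ge0// => c _.
rewrite mule_ge0// lee_fin ?invr_ge0 ?exprn_ge0//.
by rewrite /max_welfare bigmax_idl le_max lexx.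
Qed.
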